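(* Let $X$ be a Hausdorff space, let $\tau^c$ be the family of all closed subsets of $X$ and $\mathcal C_X$ the family of all compact subsets of $X$. Let $Y$ be a Hausdorff space with a strictly increasing closed cover $\{B_n\}_{n\in\mathbb N}$. Then $X$ is a $\gamma$-space if and only if there exists a map $\phi:\mathcal C_X\to\mathcal L(X,\mathcal F(Y))$, $K\mapsto\phi_K$, such that: (i) for each $K\in\mathcal C_X$, $K=\bigcap_{n\in\mathbb N}\phi_K^{-1}[Y\setminus B_n]$; (ii) if $K_1,K_2\in\mathcal C_X$ and $K_1\subset K_2$, then $\phi_{K_1}(x)\subset\phi_{K_2}(x)$ for all $x\in X$; (iii) for each $K\in\mathcal C_X$ and $F\in\tau^c$ with $K\cap F=\emptyset$, $\phi_K$ is bounded on $F$.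
   Context: $\mathbb N$ is the set of positive integers. A sequence $\{B_n\}_{n\in\mathbb N}$ of closed subsets of a space $Y$ is a strictly increasing closed cover of $Y$ if $Y=\bigcup_{n}B_n$, $B_1\neq\emptyset$ and $B_n\subsetneq B_{n+1}$ for each $n$. $\mathcal F(Y)$ is the family of nonempty closed subsets of $Y$. For a set-valued map $\psi:X\to\mathcal F(Y)$ and $B\subset Y$, $\psi^{-1}[B]=\{x\in X:\psi(x)\cap B\neq\emptyset\}$ and $\psi^{\#}[B]=\{x\in X:\psi(x)\subset B\}$. $\psi$ is lower semi-continuous if $\psi^{-1}[V]$ is open in $X$ for each open $V\subset Y$; $\mathcal L(X,\mathcal F(Y))$ is the set of all lower semi-continuous maps $X\to\mathcal F(Y)$. $\psi$ is bounded on $A\subset X$ if $A\subset\psi^{\#}[B_n]$ for some $n\in\mathbb N$. A $g$-function for a space $X$ with topology $\tau$ is a map $g:\mathbb N\times X\to\tau$ such that $x\in g(n,x)$ and $g(n+1,x)\subset g(n,x)$ for all $x\in X$, $n\in\mathbb N$. A space $X$ is a $\gamma$-space if there is a $g$-function $g$ for $X$ such that whenever $y_n\in g(n,x)$ and $x_n\in g(n,y_n)$ for all $n\in\mathbb N$, the point $x$ is a cluster point of the sequence $\langle x_n\rangle$. *)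

(* Defs.v *)
From mathcomp Require Import all_boot all_order.
From mathcomp Require Import all_classical topology.

Set Implicit Arguments.
Unset Strict Implicit.
Unset Printing Implicit Defensive.

Local Open Scope classical_set_scope.

(* Sequences are indexed by nat, starting at 0, instead of by the positive
   integers: the index n below stands for the positive integer n.+1. *)

Definition strictly_increasing_closed_cover (Y : topologicalType)
    (B : nat -> set Y) : Prop :=
  [/\ forall n, closed (B n),
      \bigcup_n B n = [set: Y],
      B 0 !=set0 &
      forall n, B n `<=` B n.+1 /\ B n <> B n.+1].

Definition nonempty_closed_sets (Y : topologicalType) : set (set Y) :=
  [set A | closed A /\ A !=set0].

(* Set-valued maps from X to Y are functions psi : X -> set Y. *)

Definition lower_inverse (X Y : Type) (psi : X -> set Y) (B : set Y) : set X :=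
  [set x | psi x `&` B !=set0].

Definition upper_inverse (X Y : Type) (psi : X -> set Y) (B : set Y) : set X :=
  [set x | psi x `<=` B].

Definition lower_semicontinuous_map (X Y : topologicalType)
    (psi : X -> set Y) : Prop :=
  forall V : set Y, open V -> open (lower_inverse psi V).

Definition lsc_maps (X Y : topologicalType) : set (X -> set Y) :=
  [set psi | (forall x, nonempty_closed_sets (psi x)) /\
             lower_semicontinuous_map psi].

Definition bounded_map_on (X Y : Type) (B : nat -> set Y)
    (psi : X -> set Y) (A : set X) : Prop :=
  exists n, A `<=` upper_inverse psi (B n).

Definition g_function (X : topologicalType) (g : nat -> X -> set X) : Prop :=
  forall n x, [/\ open (g n x), g n x x & g n.+1 x `<=` g n x].

Definition gamma_space (X : topologicalType) : Prop :=
  exists2 g : nat -> X -> set X, g_function g &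
    forall (x : X) (x_ y_ : nat -> X),
      (forall n, g n x (y_ n) /\ g n (y_ n) (x_ n)) ->
      cluster (x_ @ \oo) x.

(* Main.v *)
Require Import Defs.
From mathcomp Require Import all_boot all_order.
From mathcomp Require Import all_classical topology.

Local Open Scope classical_set_scope.

(** Both directions exchange decreasing sequences of open neighbourhoods of
    compact sets for lower semi-continuous maps into [Y].

    From a [gamma]-function [g], put [U_n K = \bigcup_(x in K) g n x].  A
    cluster point argument ([gamma_separates_compact]) shows that the [U_n K]
    are eventually disjoint from any closed set missing [K]; as points are
    closed, they shrink to [K].  The map [phi_K] sends [x] to the first [B_n]
    with [x] outside [U_n K], and to the whole of [Y] when no such [n] exists,
    that is, when [x] is in [K] ([staircase]).  Hence [phi_K x] escapes every
    [B_n] exactly when [x] is in [K], [phi_K] grows with [K], and [phi_K] is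
    bounded by [B_n] off [U_n K].

    From [phi], the sets of points where [phi_{x}] escapes [B_n] form a
    [g]-function.  If [y_n] is in [g n x], boundedness of [phi_{x}] off
    neighbourhoods of [x] forces [y_n --> x], so [x] together with a tail of
    [y_n] is a compact set [K] ([compact_cvg_range]) inside any prescribed open
    neighbourhood [O] of [x].  If moreover [x_n] is in [g n (y_n)], monotonicity
    of [phi] makes [phi_K (x_n)] escape [B_n]; as [phi_K] is bounded off [O],
    [x_n] ends up in [O]. *)

(** A filter on the range that does not cluster at the limit lives on a finite,
    hence compact, set of terms. *)
Lemma compact_cvg_range {X : topologicalType} (u : nat -> X) (x : X) :
  u @ \oo --> x -> compact (x |` range u).
Proof.
move=> ux F PF FK.
have [clx|/existsNP[A /existsNP[O /not_implyP[FA /not_implyP[xO AO]]]]] :=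
  pselect (cluster F x); first by exists x; split => //; left.
have [N _ uO] : \forall n \near \oo, O (u n) := ux _ xO.
pose E := u @` `I_N.
have FE : F E.
  apply: filterS (filterI FA FK) => z [Az [zx|[n _ unz]]].
    case: AO; exists z; split => //; rewrite zx; exact: nbhs_singleton.
  exists n => //=; rewrite ltnNge; apply/negP => Nn.
  by apply: AO; exists z; split => //; rewrite -unz; exact: uO.
have [z [[n _ <-] clz]] :=
  finite_compact (finite_image u (finite_II N)) PF FE.
by exists (u n); split => //; right; exists n.
Qed.

Lemma subset_chain {T : Type} {B : nat -> set T} :
  (forall n, B n `<=` B n.+1) -> forall m n, m <= n -> B m `<=` B n.
Proof.
move=> BS m n; elim: n => [|n IHn]; first by rewrite leqn0 => /eqP ->.
rewrite leq_eqVlt => /predU1P[-> //|/IHn mn].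
exact: subset_trans mn (BS n).
Qed.

Lemma subset_cochain {T : Type} {U : nat -> set T} :
  (forall n, U n.+1 `<=` U n) -> forall m n, m <= n -> U n `<=` U m.
Proof.
move=> US m n mn; rewrite -setCS.
by apply: (@subset_chain _ (fun n => ~` U n)) mn => k; rewrite setCS.
Qed.

Definition g_expansion {X : Type} (g : nat -> X -> set X) (n : nat)
  (K : set X) : set X := \bigcup_(x in K) g n x.

(** If [F] met every [g_expansion g n K], in [g n (k n)] say, then along
    indices [m n >= n] chosen with [k (m n)] in [g n x], where [x] in [K] is a
    cluster point of [k], the [gamma] condition would make [x] a cluster point
    of [F]. *)
Lemma gamma_separates_compact {X : topologicalType} {g : nat -> X -> set X}
  (gg : g_function g)
  (gammag : forall (x : X) (x_ y_ : nat -> X),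
    (forall n, g n x (y_ n) /\ g n (y_ n) (x_ n)) -> cluster (x_ @ \oo) x)
  {K F : set X} : compact K -> closed F -> K `&` F = set0 ->
  exists n, F `<=` ~` g_expansion g n K.
Proof.
move=> cK cF KF0; apply: contrapT => /forallNP FU.
have /choice[kf kfP] : forall n, exists p : X * X,
    [/\ K p.1, F p.2 & g n p.1 p.2].
  move=> n; have /existsNP[z /not_implyP[Fz /contrapT[k Kk gkz]]] := FU n.
  by exists (k, z).
have gS m n (x : X) : m <= n -> g n x `<=` g m x.
  by apply: (@subset_cochain _ (g^~ x)) => {}n; case: (gg n x).
have [x [Kx clx]] : K `&` cluster ((fst \o kf) @ \oo) !=set0.
  by apply: cK; exists 0 => // n _; case: (kfP n).
have /choice[m mP] : forall n, exists m, n <= m /\ g n x (kf m).1.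
  move=> n; have [og gx _] := gg n x.
  have [|z [[i ni <-] gz]] := clx ((fst \o kf) @` [set i | n <= i]) (g n x) _
    (open_nbhs_nbhs (conj og gx)).
    by exists n => // i /= ni; exists i.
  by exists i.
have clF : cluster ((fun n => (kf (m n)).2) @ \oo) x.
  apply: (gammag _ _ (fun n => (kf (m n)).1)) => n.
  have [nm gm] := mP n; split=> //.
  by apply: (gS _ _ _ nm); case: (kfP (m n)).
have Fx : F x.
  apply: cF => V xV; apply: clF => //.
  by exists 0 => // n _; case: (kfP (m n)).
by have : (K `&` F) x by []; rewrite KF0.
Qed.

(** For decreasing [U] and increasing [B] this is [B n] at the first [n] with
    [x] outside [U n], and all of [Y] if there is none; the intersection form
    makes closedness and monotonicity in [U] immediate. *)
Definition staircase {X Y : Type} (U : nat -> set X) (B : nat -> set Y)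
  (x : X) : set Y := \bigcap_(n in [set n | ~ U n x]) B n.

Lemma staircase_subset {X Y : Type} {U V : nat -> set X} (B : nat -> set Y)
  (x : X) : (forall n, U n `<=` V n) -> staircase U B x `<=` staircase V B x.
Proof. by move=> UV y Uy n nV; apply: Uy => Un; apply: nV; exact: UV. Qed.

(** If [N] is the first index with [y] in [B N], then the points whose value
    contains [y] include [U N.-1], or all of [X] when [N = 0]. *)
Lemma staircase_lsc {X Y : topologicalType} {U : nat -> set X}
  {B : nat -> set Y} : (forall n, open (U n)) ->
  (forall n, U n.+1 `<=` U n) -> (forall n, B n `<=` B n.+1) ->
  \bigcup_n B n = setT -> lower_semicontinuous_map (staircase U B).
Proof.
move=> oU US BS BT V oV; rewrite openE => x [y [xy Vy]].
have By : exists n, `[< B n y >].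
  have [n _ Bny] : (\bigcup_n B n) y by rewrite BT.
  by exists n; apply/asboolP.
case: (ex_minnP By) => -[|N] /asboolP BNy Nmin.
  apply: filterS filterT => z _; exists y; split=> // n _.
  exact: (subset_chain BS 0).
have UNx : U N x.
  apply: contrapT => /xy/asboolP/Nmin; by rewrite ltnn.
apply: filterS (open_nbhs_nbhs (conj (oU N) UNx)) => z UNz.
exists y; split=> // n Unz; apply: (subset_chain BS N.+1) => //.
by rewrite ltnNge; apply/negP => nN; apply: Unz; exact: (subset_cochain US n N).
Qed.

Lemma staircase_lsc_maps {X Y : topologicalType} {U : nat -> set X}
  {B : nat -> set Y} : (forall n, open (U n)) ->
  (forall n, U n.+1 `<=` U n) -> strictly_increasing_closed_cover B ->
  lsc_maps (staircase U B).
Proof.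
move=> oU US [cB BT [b B0b] BS]; have BS' n := (BS n).1.
split; last exact: staircase_lsc.
move=> x; split; first by apply: closed_bigI => n _; exact: cB.
by exists b => n _; exact: (subset_chain BS' 0).
Qed.

Lemma bigcap_lower_inverse_staircase {X Y : topologicalType}
  (U : nat -> set X) {B : nat -> set Y} :
  strictly_increasing_closed_cover B ->
  \bigcap_n lower_inverse (staircase U B) (~` B n) = \bigcap_n U n.
Proof.
move=> [_ _ _ BS]; apply/seteqP; split => x Ux n _.
  by apply: contrapT => Unx; have [y [/(_ n Unx)]] := Ux n I.
have [y [By nBy]] : B n.+1 `&` ~` B n !=set0.
  apply: contrapT => BB; case: (BS n) => BnS; apply; apply/seteqP; split=> //.
  by move=> y By; apply: contrapT => nBy; apply: BB; exists y.
by exists y; split=> // m; case; exact: Ux.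
Qed.

Definition compact_singleton {X : topologicalType} (x : X) :
  {K : set X | compact K} := exist _ [set x] (@compact_set1 X x).

Lemma lower_inverseCB_bounded {X Y : topologicalType} {B : nat -> set Y}
  {psi : X -> set Y} {O : set X} : (forall n, B n `<=` B n.+1) ->
  bounded_map_on B psi (~` O) ->
  exists m, forall n, m <= n -> lower_inverse psi (~` B n) `<=` O.
Proof.
move=> BS [m mO]; exists m => n mn z [y [zy nBy]]; apply: contrapT => /mO.
by move=> /(_ _ zy)/(subset_chain BS _ _ mn).
Qed.

Lemma gamma_space_of_maps {X Y : topologicalType} {B : nat -> set Y}
  (hB : strictly_increasing_closed_cover B)
  (phi : {K : set X | compact K} -> {psi : X -> set Y | lsc_maps psi}) :
  (forall K, sval K = \bigcap_n lower_inverse (sval (phi K)) (~` B n)) ->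
  (forall K1 K2, sval K1 `<=` sval K2 ->
     forall x, sval (phi K1) x `<=` sval (phi K2) x) ->
  (forall (K : {K : set X | compact K}) (F : set X), closed F ->
     sval K `&` F = set0 -> bounded_map_on B (sval (phi K)) F) ->
  gamma_space X.
Proof.
case: hB => cB _ _ BS phiI phiS phiB; have BS' n := (BS n).1.
have phiO (K : {K : set X | compact K}) (O : set X) : open O -> sval K `<=` O ->
    exists m, forall n, m <= n -> lower_inverse (sval (phi K)) (~` B n) `<=` O.
  move=> oO KO; apply: (lower_inverseCB_bounded BS').
  by apply: phiB; [exact: open_closedC|apply/disjoints_subset; rewrite setCK].
exists (fun n x => lower_inverse (sval (phi (compact_singleton x))) (~` B n)).
  move=> n x; split.
  - by apply: (svalP (phi _)).2; exact: closed_openC.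
  - have : sval (compact_singleton x) x by [].
    by rewrite phiI; exact.
  - by move=> z [y [zy nBy]]; exists y; split=> // /BS'.
move=> x x_ y_ xy A O0 [N _ NA].
rewrite nbhsE => -[O [oO Ox] OO0].
have yx : y_ @ \oo --> x.
  move=> W; rewrite nbhsE => -[V [oV Vx] VW].
  have [|m mV] := phiO (compact_singleton x) V oV; first by move=> _ ->.
  by exists m => // n mn; apply: VW; apply: (mV n mn); case: (xy n).
have [m _ mO] : \forall n \near \oo, O (y_ n).
  exact: yx (open_nbhs_nbhs (conj oO Ox)).
(* The terms of index at least [m] lie in [O], hence so does [K]. *)
have cK : compact (x |` range (fun n => y_ (n + m))).
  by apply: compact_cvg_range; exact: cvg_comp (cvg_addnr m) yx.
pose K : {K : set X | compact K} := exist _ _ cK.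
have [|j jO] := phiO K O oO.
  by move=> z [->|[n _ <-]] //; apply: mO; exact: leq_addl.
pose n := maxn N (maxn m j).
have [Nn mn jn] : [/\ N <= n, m <= n & j <= n].
  by rewrite /n !leq_max !leqnn !orbT.
exists (x_ n); split; first exact: NA.
apply: OO0; apply: (jO n jn).
have [_ [z [zP nBz]]] := xy n.
exists z; split=> //; apply: (phiS (compact_singleton (y_ n))) zP.
by move=> _ ->; right; exists (n - m) => //; rewrite subnK.
Qed.

Theorem theorem2p5 (X Y : topologicalType)
    (hX : hausdorff_space X) (hY : hausdorff_space Y)
    (B : nat -> set Y) (hB : strictly_increasing_closed_cover B) :
  gamma_space X <->
  exists phi : {K : set X | compact K} -> {psi : X -> set Y | lsc_maps psi},
    [/\ forall K, sval K = \bigcap_n lower_inverse (sval (phi K)) (~` B n),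
        forall K1 K2, sval K1 `<=` sval K2 ->
          forall x, sval (phi K1) x `<=` sval (phi K2) x &
        forall (K : {K : set X | compact K}) (F : set X), closed F ->
          sval K `&` F = set0 -> bounded_map_on B (sval (phi K)) F].
Proof.
split=> [[g gg gammag]|[phi [phiI phiS phiB]]]; last first.
  exact: gamma_space_of_maps hB phi phiI phiS phiB.
pose U K n := g_expansion g n K.
have oU K n : open (U K n) by apply: bigcup_open => x _; case: (gg n x).
have US K n : U K n.+1 `<=` U K n.
  by move=> z [x Kx gz]; exists x => //; have [_ _] := gg n x; exact.
exists (fun K => exist _ _ (staircase_lsc_maps (oU (sval K)) (US (sval K)) hB)).
split=> /= [[K cK]|[K1 ?] [K2 ?] /= K12 x|[K cK] F cF /= KF0].
- rewrite /= bigcap_lower_inverse_staircase//; apply/seteqP; split=> x.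
    by move=> Kx n _; exists x => //; case: (gg n x).
  move=> Ux; apply: contrapT => nKx.
  have cx : closed [set x].
    by apply: accessible_closed_set1; exact: hausdorff_accessible.
  have Kx0 : K `&` [set x] = set0.
    by apply/disjoints_subset => z Kz /= zx; apply: nKx; rewrite -zx.
  have [n /(_ x erefl)] := gamma_separates_compact gg gammag cK cx Kx0.
  by apply; exact: Ux.
- apply: staircase_subset => n; exact: bigcup_subset.
- have [n FU] := gamma_separates_compact gg gammag cK cF KF0.
  by exists n => x /FU nUx y; exact.
Qed.
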